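(* Let $\kappa$ be a cardinal with $\aleph_1\le\kappa\le\mathfrak c$ and let $E$ be a zero-dimensional subset of a compact metric space $X$. If there exists a continuous function on $E$ with values in a compact metric space $Y$ which is not uniformly continuous on any subset of $E$ of cardinality $\kappa$, then there is also a continuous function on $E$, not uniformly continuous on any subset of $E$ of cardinality $\kappa$, with values in the Cantor ternary set $C\subseteq[0,1]$. Consequently, for any uncountable compact metric space $Z$, there is also a continuous function on $E$ with values in $Z$ which is not uniformly continuous on any subset of $E$ of cardinality $\kappa$.
   Context: $\mathfrak c=2^{\aleph_0}$. $E$ carries the metric inherited from $X$. A function is (not) uniformly continuous on a set $A$ if its restriction to $A$ is (not) uniformly continuous. A separable metrizable space is zero-dimensional if it has a base of clopen sets. *)

(* Defs.v *)
From HB Require Import structures.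
From mathcomp Require Import all_boot all_order all_algebra.
From mathcomp Require Import all_classical all_reals all_analysis.

Set Implicit Arguments.
Unset Strict Implicit.
Unset Printing Implicit Defensive.

Import Order.TTheory GRing.Theory Num.Theory.
Import numFieldNormedType.Exports.

Local Open Scope classical_set_scope.
Local Open Scope card_scope.
Local Open Scope ring_scope.

(* For metric spaces, stronger in general than the library's [zero_dimensional],
   which only asks that distinct points be separated by a clopen set. *)
Definition has_clopen_basis (T : topologicalType) : Prop :=
  exists2 B : set_system T, basis B & B `<=` clopen.

(* A cardinal is represented by any set [K] of that cardinality.  The restriction
   [sigL A f] lives on the subtype [A], with the uniformity induced from [T]. *)
Definition not_unif_continuous_on_card (U : Type) (K : set U)
    (T Y : uniformType) (f : T -> Y) : Prop :=
  forall A : set T, A #= K -> ~ unif_continuous (sigL A f).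

Fixpoint cantor_stage (R : realType) (n : nat) : set R :=
  if n is m.+1 then
    [set x / 3 | x in cantor_stage m] `|`
    [set (x + 2) / 3 | x in cantor_stage m]
  else `[0, 1].

Definition cantor_ternary (R : realType) : set R :=
  \bigcap_n cantor_stage n.
Arguments cantor_ternary : clear implicits.

(* Main.v *)
Require Import Defs.
From HB Require Import structures.
From mathcomp Require Import all_boot all_order all_algebra.
From mathcomp Require Import all_classical all_reals all_analysis.
From mathcomp Require Import ring lra.

(** The argument replaces [f] by a map [g] into the Cantor space [2^nat] that is
    at least as far from being uniformly continuous, and then embeds [2^nat]
    into the required target.

    Since [Y] is compact, there are countably many pairs [(P_n, Q_n)] of
    disjoint closed subsets of [Y] that detect uniform continuity: a map into
    [Y] is uniformly continuous as soon as, for each [n], the preimages of [P_n]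
    and [Q_n] are uniformly apart ([unif_continuous_test_pairs]).  The space [E]
    has a base of clopen sets and, being a subspace of a compact metric space, a
    countable network; so disjoint closed subsets of [E] are separated by a
    clopen set ([clopen_separation]).  Choose a clopen [D_n] containing the
    preimage of [P_n] and missing that of [Q_n], and let the [n]-th bit of
    [g x] say whether [x] lies in [D_n].  Then [g] is continuous, and whenever
    every bit of [g] is uniformly locally constant on a set [A], the map [f] is
    uniformly continuous on [A] ([bitwise_test_function]).

    If [phi] is a continuous injection of [2^nat] into a Hausdorff
    (pseudo)metric space, the images of [{b | b n = 0}] and [{b | b n = 1}] are
    disjoint compact sets, hence at positive distance
    ([continuous_injection_separates_bits]).  So uniform continuity of
    [phi \o g] on [A] makes each bit of [g] uniformly locally constant on [A],
    and therefore [f] uniformly continuous on [A].  This holds for each single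
    set [A], whatever its cardinality.

    It remains to provide [phi].  For the ternary set it is the map sending a
    binary sequence [b] to the sum of the [2 * b_i / 3 ^ (i + 1)]; for an
    uncountable compact metric space it is given by a Cantor scheme of
    uncountable closed sets ([cantor_embedding]). *)

Set Implicit Arguments.
Unset Strict Implicit.
Unset Printing Implicit Defensive.

Import Order.TTheory GRing.Theory Num.Theory.
Import numFieldNormedType.Exports.

Local Open Scope classical_set_scope.
Local Open Scope card_scope.
Local Open Scope ring_scope.

(** * Finite nets and countable networks *)

(** Compactness as an induction principle: an ideal of sets that contains a
    neighbourhood of each point of [A] contains [A]. *)
Lemma compact_set_ind (T : topologicalType) (A : set T) (Q : set T -> Prop) :
  compact A -> Q set0 -> (forall U V, U `<=` V -> Q V -> Q U) ->
  (forall U V, Q U -> Q V -> Q (U `|` V)) ->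
  (forall x, A x -> exists2 V, nbhs x V & Q V) -> Q A.
Proof.
move=> /compact_near_coveringP cA Q0 Qsub QU Qloc.
(* Near-covering is applied to the membership relation and to the filter in
   which a set [W] eventually includes any given member of the ideal. *)
pose F := filter_from Q (fun U => [set W | U `<=` W]).
have FF : Filter F.
  apply: filter_from_filter; first by exists set0.
  move=> U V QU' QV; exists (U `|` V); first exact: QU.
  by move=> W; rewrite /= subUset.
have [x Ax|U QU' /(_ U) AU] := cA (set T) F (fun W x => W x) FF.
  have [V Vx QV] := Qloc x Ax.
  exists (V, [set W | V `<=` W]) => /=; first by split=> //; exists V.
  by case=> x' W /= [Vx']; apply.
exact: Qsub (AU _) QU'.
Qed.

Lemma compact_finite_net (R : realType) (T : pseudoMetricType R) (e : R) :
  compact [set: T] -> 0 < e ->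
  exists s : seq T, forall x, exists2 y, y \in s & ball y e x.
Proof.
move=> cT e0.
suff [s sT] : exists s : seq T, forall x, [set: T] x ->
    exists2 y, y \in s & ball y e x by exists s => x; exact: sT.
apply: (@compact_set_ind _ _
  (fun A => exists s : seq T, forall x, A x -> _) cT).
- by exists [::].
- by move=> U V UV [s sV]; exists s => x /UV/sV.
- move=> U V [s sU] [t tV]; exists (s ++ t) => x.
  by case=> [/sU|/tV] [y ys yx]; exists y; rewrite // mem_cat ys ?orbT.
- move=> x _; exists (ball x e); first exact: nbhsx_ballx.
  by exists [:: x] => z xz; exists x; rewrite ?mem_head.
Qed.

Lemma compact_countable_nets (R : realType) (T : pseudoMetricType R) :
  compact [set: T] ->
  exists s : nat -> seq T,
    forall k x, exists2 y, y \in s k & ball y k.+1%:R^-1 x.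
Proof.
move=> cT; have /choice[s sP] : forall k, exists s : seq T,
    forall x, exists2 y, y \in s & ball y (k.+1%:R^-1 : R) x.
  by move=> k; exact: compact_finite_net.
by exists s.
Qed.

(** A countable network: like a countable base, except that the members [M n]
    need not be open.  It is inherited by subspaces. *)
Definition countable_network (T : topologicalType) (M : nat -> set T) :=
  forall x V, nbhs x V -> exists2 n, M n x & M n `<=` V.

Lemma compact_countable_network (R : realType) (T : pseudoMetricType R) :
  compact [set: T] -> exists M : nat -> set T, countable_network M.
Proof.
move=> /compact_countable_nets[s sP].
(* [M] lists the balls of radius [1 / (k + 1)] around the [i]-th point of the
   [k]-th net, the pair [(k, i)] being coded as a natural number. *)
pose M (n : nat) : set T :=
  if unpickle n is Some (k, i) then
    [set x | if onth (s k) i is Some y then ball y k.+1%:R^-1 x else False]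
  else set0.
exists M => x V /nbhs_ballP[e /= e0 eV].
have [k] := @ltr_add_invr R 0 (e / 2) (divr_gt0 e0 (ltr0Sn _ 1)).
rewrite add0r => ke; have [y ys yx] := sP k x.
have /onthP[i iy] := ys.
have Mki : M (pickle (k, i)) = ball y k.+1%:R^-1 by rewrite /M pickleK iy.
exists (pickle (k, i)); rewrite Mki // => z yz.
apply: eV; rewrite (splitr e); apply: (@ball_triangle _ _ y).
  by apply: ball_sym; apply: le_ball (ltW ke) _ yx.
exact: le_ball (ltW ke) _ yz.
Qed.

Lemma countable_network_sub (T : topologicalType) (A : set T)
  (M : nat -> set T) : countable_network M ->
  countable_network (fun n => set_val @^-1` M n : set (set_type A)).
Proof.
move=> MP x V [_ [[W oW <-] Wx WV]].
have [n Mx MW] := MP (set_val x) W (open_nbhs_nbhs (conj oW Wx)).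
by exists n => // y My; apply/WV/MW.
Qed.

(** * Clopen separation of closed sets *)

(** Under a countable network, a base of clopen sets yields the separation of
    disjoint closed sets, not only of points from closed sets: countably many
    clopen sets, each missing [F] or [G], cover the space; once made disjoint,
    those that meet [F] have a clopen union. *)
Lemma clopen_separation (T : topologicalType) (M : nat -> set T) (F G : set T) :
  has_clopen_basis T -> countable_network M ->
  closed F -> closed G -> F `&` G = set0 ->
  exists D : set T, [/\ clopen D, F `<=` D & D `&` G = set0].
Proof.
move=> [B [_ Bnbhs] Bclopen] Mnet cF cG FG0.
pose good U := clopen U /\ (U `&` F = set0 \/ U `&` G = set0).
(* [U n] is a good set containing [M n] whenever such a set exists. *)
have /choice[U UP] : forall n, exists U : set T, good U /\
    ((exists2 V, good V & M n `<=` V) -> M n `<=` U).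
  move=> n; have [[V gV MV]|noV] := pselect (exists2 V, good V & M n `<=` V).
    by exists V.
  by exists set0; split=> //; split; [exact: clopen0|left; rewrite set0I].
have Ucover x : exists n, U n x.
  have [V gV Vx] : exists2 V, good V & V x.
    have sepV (H : set T) : closed H -> ~ H x ->
        exists2 V, clopen V /\ V `&` H = set0 & V x.
      move=> cH Hx.
      have [V [BV Vx] VH] := Bnbhs x _
        (open_nbhs_nbhs (conj (closed_openC cH) Hx)).
      exists V => //; split; first exact: Bclopen.
      by rewrite -subset0 => z [/VH].
    have [Fx|/(sepV _ cF)[V [cV V0] Vx]] := pselect (F x); last first.
      by exists V => //; split=> //; left.
    have Gx : ~ G x by move=> Gx; have : (F `&` G) x by []; rewrite FG0.
    have [V [cV V0] Vx] := sepV _ cG Gx.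
    by exists V => //; split=> //; right.
  have nVx : nbhs x V by apply: open_nbhs_nbhs; split=> //; case: gV => -[].
  have [n Mnx MnV] := Mnet x V nVx.
  by exists n; apply: (proj2 (UP n)) => //; exists V.
(* Disjointification of [U], still made of clopen sets. *)
pose W := seqDU U.
have cW n : clopen (W n).
  rewrite /W /seqDU; apply: clopenI; first by case: (UP n) => -[].
  apply: clopenC; first exact: setT.
  rewrite -(big_mkord xpredT U); elim: n => [|n IH].
    by rewrite big_geq //; exact: clopen0.
  by rewrite big_nat_recr //=; apply: clopenU => //; case: (UP n) => -[].
have Wcover x : exists n, W n x.
  have [n Unx] := Ucover x.
  have : (\bigcup_k U k) x by exists n.
  by rewrite seqDU_bigcup_eq => -[m _ Wm]; exists m.
pose D := \bigcup_(n in [set n | W n `&` F !=set0]) W n.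
have WDC n : ~ (W n `&` F !=set0) -> W n `<=` ~` D.
  move=> nWF x Wnx [m /= WmF Wmx]; apply: nWF.
  by have -> : n = m by apply: (@trivIset_seqDU _ U) => //; exists x.
exists D; split.
- split; first by apply: bigcup_open => n _; case: (cW n).
  rewrite -openC (_ : ~` D =
    \bigcup_(n in [set n | ~ (W n `&` F !=set0)]) W n).
    by apply: bigcup_open => n _; case: (cW n).
  apply/seteqP; split=> [x Dx|x [n /= nWF Wnx]]; last exact: WDC Wnx.
  have [n Wnx] := Wcover x; exists n => //= WF.
  by apply: Dx; exists n.
- move=> x Fx; have [n Wnx] := Wcover x.
  by exists n => //=; exists x.
- rewrite -subset0 => x [[n /= [y [Wny Fy]] Wnx] Gx].
  have [[_ [UF|UG]] _] := UP n.
    have : (U n `&` F) y by split=> //; exact: subset_seqDU Wny.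
    by rewrite UF.
  have : (U n `&` G) x by split=> //; exact: subset_seqDU Wnx.
  by rewrite UG.
Qed.

(** * Testing uniform continuity with countably many pairs *)

Lemma closure_ball_le (R : realType) (T : pseudoMetricType R) (y : T)
  (r s : R) :
  0 < r -> r < s -> closure (ball y r) `<=` ball y s.
Proof.
move=> r0 rs z cz.
have sr0 : 0 < s - r by rewrite subr_gt0.
have [w [yw zw]] := cz _ (nbhsx_ballx z _ sr0).
rewrite -(subrKC r s); apply: ball_triangle yw _; exact: ball_sym.
Qed.

(** The pairs are the closures of [ball y r] and of the complement of
    [ball y (3 * r)], where [r = 1 / (k + 1)] and [y] runs through a finite
    [r]-net.  For a given precision only the finitely many pairs of a single net
    matter, so the corresponding entourages can be intersected. *)
Lemma unif_continuous_test_pairs (R : realType) (Y : pseudoMetricType R) :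
  compact [set: Y] ->
  exists PQ : nat -> set Y * set Y,
    (forall n, [/\ closed (PQ n).1, closed (PQ n).2 &
                   (PQ n).1 `&` (PQ n).2 = set0]) /\
    forall (T : uniformType) (f : T -> Y),
      (forall n, \forall xy \near @entourage T,
         ~ ((PQ n).1 (f xy.1) /\ (PQ n).2 (f xy.2))) ->
      unif_continuous f.
Proof.
move=> /compact_countable_nets[s sP].
pose PQ (n : nat) : set Y * set Y :=
  if unpickle n is Some (k, i) then
    if onth (s k) i is Some y then
      (closure (ball y k.+1%:R^-1), closure (~` ball y (3 * k.+1%:R^-1)))
    else (set0, set0)
  else (set0, set0).
exists PQ; split=> [n|T f fPQ].
  rewrite /PQ; case: (unpickle n) => [[k i]|] /=; last first.
    by split; [exact: closed0|exact: closed0|rewrite set0I].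
  case: (onth (s k) i) => [y|] /=; last first.
    by split; [exact: closed0|exact: closed0|rewrite set0I].
  split; [exact: closed_closure|exact: closed_closure|].
  have r0 : 0 < k.+1%:R^-1 :> R by rewrite invr_gt0.
  rewrite -subset0 => z [z1 z2].
  have yz : ball y (2 * k.+1%:R^-1) z.
    by apply: closure_ball_le z1 => //; rewrite ltr_pMl // ltr1n.
  have [w [yw zw]] := z2 _ (nbhsx_ballx z _ r0); apply: yw.
  rewrite (_ : 3 * _ = 2 * k.+1%:R^-1 + k.+1%:R^-1 :> R); last by ring.
  exact: ball_triangle yz zw.
move=> V; rewrite /= -entourage_ballE => -[e /= e0 eV].
have [k] := @ltr_add_invr R 0 (e / 4) (divr_gt0 e0 (ltr0Sn _ 3)).
rewrite add0r => ke.
pose near_i (i : 'I_(size (s k))) : set (T * T) :=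
  [set xy | ~ ((PQ (pickle (k, val i))).1 (f xy.1) /\
               (PQ (pickle (k, val i))).2 (f xy.2))].
have /filter_forall : forall i, \forall xy \near @entourage T, near_i i xy.
  by move=> i; exact: fPQ.
rewrite /nbhs/=.
apply: filterS => -[x x'] /= xx'; apply: eV => /=.
have [y ys yx] := sP k (f x).
have /onthP[i iy] := ys.
have i_lt : (i < size (s k))%N by rewrite -onthTE iy.
have := xx' (Ordinal i_lt); rewrite /near_i /PQ /= pickleK iy /= => nPQ.
have yx' : ball y (3 * k.+1%:R^-1) (f x').
  apply: contrapT => yx'; apply: nPQ.
  by split; exact: subset_closure.
apply: (@le_ball _ _ _ (k.+1%:R^-1 + 3 * k.+1%:R^-1)).
  by move: ke; set r := k.+1%:R^-1; lra.
by apply: ball_triangle yx'; exact: ball_sym.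
Qed.

(** * Maps to and from the Cantor space *)

Lemma continuous_to_cantor (T : topologicalType) (D : nat -> set T) :
  (forall n, clopen (D n)) ->
  continuous (fun x => (fun n => `[< D n x >]) : cantor_space).
Proof.
move=> cD x0; apply/cvg_sup => n V [_ [[W oW <-] Wx WV]].
have ctn : continuous (fun x => `[< D n x >]).
  move=> x U /principal_filterP Ux.
  have [Dx|Dx] := pselect (D n x).
    apply: (@filterS _ _ _ (D n)) => [y Dy|].
      by rewrite /= (asboolT Dy) -(asboolT Dx).
    by apply: open_nbhs_nbhs; split=> //; case: (cD n).
  apply: (@filterS _ _ _ (~` D n)) => [y Dy|].
    by rewrite /= (asboolF Dy) -(asboolF Dx).
  by apply: open_nbhs_nbhs; split=> //; apply: closed_openC; case: (cD n).
apply: filterS WV _; apply: (ctn x0 W); exact: open_nbhs_nbhs.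
Qed.

Lemma cantor_cylinder_nbhs (b : cantor_space) (n : nat) :
  nbhs b [set c : cantor_space | forall i, (i < n)%N -> c i = b i].
Proof.
elim: n => [|n IH]; first by apply: filterS filterT => c _ i.
have nb : nbhs b [set c : cantor_space | c n = b n].
  have := @proj_continuous nat (fun=> bool) n b [set b n].
  by apply; apply/principal_filterP.
apply: filterS2 IH nb => c cb cn i.
by rewrite ltnS leq_eqVlt => /predU1P[->//|/cb].
Qed.

Lemma compact_disjoint_ball (R : realType) (T : pseudoMetricType R)
  (P Q : set T) : compact P -> closed Q -> P `&` Q = set0 ->
  exists2 e : R, 0 < e & forall p q, P p -> Q q -> ~ ball p e q.
Proof.
move=> cP cQ PQ0.
suff [e e0 eP] : exists2 e : R, 0 < e &
    forall p, P p -> forall q, Q q -> ~ ball p e q.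
  by exists e => // p q Pp; exact: eP.
apply: (@compact_set_ind T P (fun U => exists2 e : R, 0 < e &
  forall p, U p -> forall q, Q q -> ~ ball p e q) cP).
- by exists 1 => //.
- by move=> U V UV [e e0 eV]; exists e => // p /UV/eV.
- move=> U V [d d0 dU] [e e0 eV]; exists (Num.min d e).
    by rewrite lt_min d0.
  move=> p [/dU|/eV] {}h q Qq pq; apply: (h q Qq); apply: le_ball pq.
    by rewrite ge_min lexx.
  by rewrite ge_min lexx orbT.
- move=> p Pp.
  have nQp : nbhs p (~` Q).
    apply: open_nbhs_nbhs; split; first exact: closed_openC.
    by move=> Qp; have : (P `&` Q) p by []; rewrite PQ0.
  have /nbhs_ballP[e /= e0 eQ] := nQp.
  have e20 : 0 < e / 2 by rewrite divr_gt0.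
  exists (ball p (e / 2)); first exact: nbhsx_ballx.
  exists (e / 2) => // x px q Qq xq; apply: (eQ q) => //.
  by rewrite (splitr e); exact: ball_triangle px xq.
Qed.

(** The inverse of a continuous injection of the Cantor space is uniformly
    continuous on its image, stated one coordinate at a time. *)
Lemma continuous_injection_separates_bits (R : realType)
  (T : pseudoMetricType R) (phi : cantor_space -> T) (m : nat) :
  hausdorff_space T -> continuous phi -> injective phi ->
  exists2 e : R, 0 < e & forall b c, ball (phi b) e (phi c) -> b m = c m.
Proof.
move=> hT cphi iphi.
pose S (v : bool) := phi @` [set b : cantor_space | b m = v].
have cS v : compact (S v).
  apply: continuous_compact; first exact: continuous_subspaceT.
  apply: subclosed_compact cantor_space_compact _ => //.
  rewrite (_ : [set b | _] = @proj nat (fun=> bool) m @^-1` [set v]) //.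
  apply: preimage_closed; last exact: discrete_closed.
  by move=> b _; exact: proj_continuous.
have cSf := compact_closed hT (cS false).
have [|e e0 eS] := compact_disjoint_ball (cS true) cSf.
  rewrite -subset0 => _ [[b /= bm <-] [c /= cm /iphi cb]].
  by move: bm; rewrite -cb cm.
exists e => // b c; case bm: (b m); case cm: (c m) => // bc; exfalso.
  by apply: eS bc; [exists b|exists c].
by apply: eS (ball_sym bc); [exists c|exists b].
Qed.

(** * Ternary expansions *)

Section ternary_digits.
Context (R : realType).

(** Sum of the first [n] terms of [2 * b_i / 3 ^ (i + 1)], in Horner form: the
    recursion peels off the leading digit and shifts [b]. *)
Fixpoint ternary_partial (n : nat) (b : nat -> bool) : R :=
  if n is m.+1 then ((b 0%N)%:R * 2 + ternary_partial m (b \o succn)) / 3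
  else 0.

(** The point of the Cantor ternary set with binary address [b]. *)
Definition ternary (b : cantor_space) : R :=
  limn (fun n => ternary_partial n b).

Lemma ternary_partial_itv n b : 0 <= ternary_partial n b <= 1.
Proof.
elim: n b => [|n IH] b /=; first by rewrite lexx ler01.
by have /andP[] := IH (b \o succn); case: (b 0%N) => /=; lra.
Qed.

Lemma ternary_partial_nondecreasing b :
  {homo (fun n => ternary_partial n b) : n m / (n <= m)%N >-> n <= m}.
Proof.
apply/nondecreasing_seqP => n; elim: n b => [|n IH] b.
  by have /andP[] := ternary_partial_itv 1 b.
by have := IH (b \o succn); rewrite /=; lra.
Qed.

Lemma cvg_ternary_partial b :
  (fun n => ternary_partial n b) @ \oo --> ternary b.
Proof.
apply: (@nondecreasing_is_cvgn R); first exact: ternary_partial_nondecreasing.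
by exists 1 => _ [n _ <-]; have /andP[] := ternary_partial_itv n b.
Qed.

Lemma ternaryE b : ternary b = ((b 0%N)%:R * 2 + ternary (b \o succn)) / 3.
Proof.
have cvgS : (fun n => ternary_partial n.+1 b) @ \oo --> ternary b.
  have := @cvg_ternary_partial b.
  by rewrite -(cvg_shiftS (fun n => ternary_partial n b)).
apply: (cvg_unique (@Rhausdorff R) cvgS).
apply: cvgM; last exact: cvg_cst.
apply: cvgD; first exact: cvg_cst.
exact: cvg_ternary_partial.
Qed.

Lemma ternary_itv b : 0 <= ternary b <= 1.
Proof.
have cb := cvgP _ (@cvg_ternary_partial b).
apply/andP; split; [apply: limr_ge|apply: limr_le] => //; apply: nearW => n.
  by have /andP[] := ternary_partial_itv n b.
by have /andP[] := ternary_partial_itv n b.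
Qed.

Lemma ternary_in_cantor b : cantor_ternary R (ternary b).
Proof.
move=> n _; elim: n b => [|n IH] b /=.
  by rewrite in_itv /= ternary_itv.
rewrite ternaryE; case: (b 0%N) => /=; [right|left].
  by exists (ternary (b \o succn)) => //; rewrite mul1r addrC.
by exists (ternary (b \o succn)) => //; rewrite mul0r add0r.
Qed.

Lemma ternary_eq0 b c : ternary b = ternary c -> b 0%N = c 0%N.
Proof.
rewrite (ternaryE b) (ternaryE c).
have /andP[? ?] := ternary_itv (b \o succn).
have /andP[? ?] := ternary_itv (c \o succn).
by case: (b 0%N); case: (c 0%N) => //=; lra.
Qed.

Lemma ternary_inj : injective ternary.
Proof.
move=> b c bc; apply/funext => n; elim: n b c bc => [|n IH] b c bc.
  exact: ternary_eq0.
have bc0 := ternary_eq0 bc.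
apply: (IH (b \o succn) (c \o succn)); move: bc.
by rewrite (ternaryE b) (ternaryE c) bc0; lra.
Qed.

Lemma ternary_prefix n b c : (forall i, (i < n)%N -> c i = b i) ->
  `|ternary b - ternary c| <= 3 ^- n.
Proof.
elim: n b c => [|n IH] b c bc.
  have := ternary_itv b; have := ternary_itv c.
  by rewrite expr0 invr1 ler_norml; lra.
rewrite (ternaryE b) (ternaryE c) bc // exprS invfM.
have := IH (b \o succn) (c \o succn) (fun i ni => bc i.+1 ni).
by rewrite !ler_norml; lra.
Qed.

Lemma ternary_continuous : continuous ternary.
Proof.
move=> b; apply/cvgrPdist_le => e e0.
have [n ne] : exists n, 3 ^- n <= e.
  have [k] := @ltr_add_invr R 0 e e0; rewrite add0r => ke; exists k.+1.
  apply: le_trans (ltW ke); rewrite lef_pV2 ?posrE ?exprn_gt0 ?ltr0Sn //.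
  by rewrite -natrX ler_nat ltnW // ltn_expl.
apply: filterS (cantor_cylinder_nbhs b n) => c bc.
exact: le_trans (ternary_prefix bc) ne.
Qed.

End ternary_digits.

(** * Cantor schemes in uncountable compact spaces *)

Lemma countable_setU (T : Type) (U V : set T) :
  countable U -> countable V -> countable (U `|` V).
Proof.
move=> cU cV; rewrite -bigcup2E; apply: bigcup_countable => // -[|[|n]] _ //=.
Qed.

Section cantor_scheme.
Context (R : realType) (Z : pseudoMetricType R).
Context (cZ : compact [set: Z]) (hZ : hausdorff_space Z).

(** Every neighbourhood of [p] meets [F] in an uncountable set; [p] itself need
    not lie in [F]. *)
Definition condensation_point (F : set Z) (p : Z) :=
  forall V, nbhs p V -> ~ countable (F `&` V).

Lemma exists_condensation_point (F : set Z) :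
  closed F -> ~ countable F -> exists2 p, F p & condensation_point F p.
Proof.
move=> cF uF; apply: contrapT => nop; apply: uF.
rewrite -(setIid F).
apply: (@compact_set_ind Z F (fun U => countable (F `&` U))).
- exact: subclosed_compact cF cZ _.
- by rewrite setI0; exact: countable0.
- by move=> U V UV; apply: sub_countable; apply: subset_card_le; exact: setIS.
- by move=> U V cU cV; rewrite setIUr; exact: countable_setU.
- move=> x Fx; apply: contrapT => noV; apply: nop; exists x => // V Vx FV.
  by apply: noV; exists V.
Qed.

Lemma hausdorff_ball_neq (p q : Z) : p <> q ->
  exists2 r : R, 0 < r & ball p r `&` ball q r = set0.
Proof.
move: hZ; rewrite ball_hausdorff => hZ' /eqP /hZ'[[r s] /= /eqP rs0].
exists (Num.min r%:num s%:num); first by rewrite lt_min !gt0.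
rewrite -subset0 -rs0; apply: setISS; apply: le_ball; rewrite ge_min lexx //.
by rewrite orbT.
Qed.

Lemma exists_two_condensation_points (F : set Z) :
  closed F -> ~ countable F ->
  exists p q, [/\ p <> q, condensation_point F p & condensation_point F q].
Proof.
move=> cF uF; have [p Fp cp] := exists_condensation_point cF uF.
(* [F] minus [p] is the union of the closed sets [F' n], so one of these is
   uncountable and has a condensation point of its own. *)
pose F' n := F `\` (ball p (n.+1%:R^-1 : R))°.
have [n uF'] : exists n, ~ countable (F' n).
  apply: contrapT => /forallNP cF'; apply: uF.
  have : countable ([set p] `|` \bigcup_n F' n).
    apply: countable_setU; first exact: countable1.
    by apply: bigcup_countable => // n _; apply: contrapT; exact: cF'.
  apply: sub_countable; apply: subset_card_le => x Fx.
  have [->|xp] := pselect (x = p); first by left.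
  right; have [|r r0 pxr] := @hausdorff_ball_neq p x.
    by move=> px; apply: xp.
  have [n] := @ltr_add_invr R 0 r r0; rewrite add0r => nr.
  exists n => //; split=> // /interior_subset px.
  have : (ball p r `&` ball x r) x.
    by split; [exact: le_ball (ltW nr) _ px|exact: ballxx].
  by rewrite pxr.
have cF' : closed (F' n).
  by apply: closedI => //; apply: open_closedC; exact: open_interior.
have [q [Fq pq] cq] := exists_condensation_point cF' uF'.
exists p, q; split=> // [pq'|V Vq FV].
  by apply: pq; rewrite -pq'; exact: nbhsx_ballx.
apply: (cq V Vq); apply: sub_countable FV; apply: subset_card_le.
by apply: setSI => x [].
Qed.

(** The invariant of the members of the Cantor scheme. *)
Definition uncountable_closed (F : set Z) := closed F /\ ~ countable F.

(** One step of the scheme: two disjoint uncountable closed subsets of diameter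
    at most [e], cut out of [F] by small balls around two condensation
    points. *)
Lemma cantor_scheme_split (F : set Z) (e : R) :
  0 < e -> uncountable_closed F ->
  exists G : bool -> set Z,
    [/\ forall v, uncountable_closed (G v), forall v, G v `<=` F,
        G true `&` G false = set0 &
        forall v x y, G v x -> G v y -> ball x e y].
Proof.
move=> e0 [cF uF].
have [p [q [pq cp cq]]] := exists_two_condensation_points cF uF.
have [r r0 pqr] := hausdorff_ball_neq pq.
pose d := Num.min (r / 2) (e / 4).
have d0 : 0 < d by rewrite lt_min !divr_gt0.
pose c (v : bool) := if v then p else q.
pose G v := F `&` closure (ball (c v) d).
have Gball v s : d < s -> G v `<=` ball (c v) s.
  by move=> ds x [_]; exact: closure_ball_le.
exists G; split.
- move=> v; split; first by apply: closedI => //; exact: closed_closure.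
  have : condensation_point F (c v) by case: v.
  move=> /(_ _ (nbhsx_ballx (c v) _ d0)); apply: contra_not.
  apply: sub_countable; apply: subset_card_le; apply: setIS.
  exact: subset_closure.
- by move=> v x [].
- rewrite -subset0 -pqr; apply: setISS; apply: Gball; rewrite gt_min.
    by rewrite ltr_pdivrMr // ltr_pMr // ltr1n.
  by rewrite ltr_pdivrMr // ltr_pMr // ltr1n.
- move=> v x y Gx Gy; rewrite (splitr e); apply: (@ball_triangle _ _ (c v)).
    by apply: ball_sym; apply: Gball Gx; rewrite gt_min; apply/orP; right; lra.
  by apply: Gball Gy; rewrite gt_min; apply/orP; right; lra.
Qed.

Lemma compact_nested_nonempty (D : nat -> set Z) :
  (forall n, closed (D n)) -> (forall n, D n !=set0) ->
  (forall n, D n.+1 `<=` D n) -> (\bigcap_n D n) !=set0.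
Proof.
move=> cD D0 Ddec.
have Dhomo m n : (m <= n)%N -> D n `<=` D m.
  by move=> /subnK <-; elim: (n - m)%N => // k IH x /Ddec/IH.
pose F := filter_from setT D.
have FF : ProperFilter F.
  apply: filter_from_proper => //.
  apply: filter_from_filter; first by exists 0%N.
  move=> m n _ _; exists (maxn m n) => // x Dx.
  by split; apply: Dhomo Dx; rewrite ?leq_maxl ?leq_maxr.
have [z [_ zF]] := cZ FF filterT.
exists z => n _; apply: (cD n) => V Vz.
by apply: zF => //; exists n.
Qed.

(** Every uncountable compact metric space contains a homeomorphic copy of the
    Cantor space. *)
Lemma cantor_embedding : ~ countable [set: Z] ->
  exists2 phi : cantor_space -> Z, continuous phi & injective phi.
Proof.
move=> uZ.
have /choice[g gP] : forall Fn : set Z * nat, exists G : bool -> set Z,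
    uncountable_closed Fn.1 ->
    [/\ forall v, uncountable_closed (G v), forall v, G v `<=` Fn.1,
        G true `&` G false = set0 &
        forall v x y, G v x -> G v y -> ball x (Fn.2.+1%:R^-1 : R) y].
  move=> [F n] /=; have [uF|nuF] := pselect (uncountable_closed F).
    have [|G GP] := @cantor_scheme_split F (n.+1%:R^-1) _ uF; last by exists G.
    by rewrite invr_gt0.
  by exists (fun=> set0).
(* [D b n] is the member of the scheme indexed by the first [n] bits of [b]. *)
pose fix D (b : nat -> bool) n :=
  if n is m.+1 then g (D b m, m) (b m) else [set: Z].
have uD b n : uncountable_closed (D b n).
  elim: n => [|n IH] /=; first by split=> //; exact: closedT.
  by case: (gP (D b n, n) IH).
have /choice[phi phiP] : forall b : cantor_space, exists z, (\bigcap_n D b n) z.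
  move=> b; apply: compact_nested_nonempty => n.
  - by case: (uD b n).
  - apply/set0P/eqP => D0; have [_] := uD b n; apply; rewrite D0.
    exact: countable0.
  - by case: (gP (D b n, n) (uD b n)) => _ /(_ (b n)).
have Dprefix b c n : (forall i, (i < n)%N -> c i = b i) -> D c n = D b n.
  elim: n => [//|n IH] cb /=; rewrite cb // IH // => i /ltnW; exact: cb.
exists phi => [b|b c bc].
  apply/cvg_ballP => e e0.
  have [n] := @ltr_add_invr R 0 e e0; rewrite add0r => ne.
  apply: filterS (cantor_cylinder_nbhs b n.+1) => c cb.
  apply: le_ball (ltW ne) _ _.
  case: (gP (D b n, n) (uD b n)) => _ _ _ /(_ (b n)); apply.
    exact: (phiP b n.+1 I).
  by have := phiP c n.+1 I; rewrite (Dprefix _ _ _ cb).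
apply/funext; suff cb n : forall i, (i < n)%N -> c i = b i.
  by move=> i; rewrite (cb i.+1).
elim: n => [//|n IH] i; rewrite ltnS leq_eqVlt => /predU1P[->|/IH//].
have Dn := Dprefix _ _ _ IH.
have := phiP b n.+1 I; have := phiP c n.+1 I; rewrite /= Dn -bc => h1 h2.
have [_ _ + _] := gP (D b n, n) (uD b n); rewrite -subset0.
by move: h1 h2; case: (b n); case: (c n) => // h1 h2 /(_ (phi b)) [].
Qed.

End cantor_scheme.

(** * Uniform continuity through the Cantor space *)

(** Reduction to values in the Cantor space.  The entourage condition says that
    each bit of [g] is uniformly locally constant on [A], that is, that [g] is
    uniformly continuous on [A]. *)
Lemma bitwise_test_function (R : realType) (X Y : pseudoMetricType R)
  (E : set X) (f : set_type E -> Y) :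
  compact [set: X] -> has_clopen_basis (set_type E) ->
  compact [set: Y] -> continuous f ->
  exists g : set_type E -> cantor_space, continuous g /\
    forall A : set (set_type E),
      (forall n, \forall xy \near @entourage (set_type A),
         g (set_val xy.1) n = g (set_val xy.2) n) ->
      unif_continuous (sigL A f).
Proof.
move=> cX zE cY cf.
have [PQ [PQP PQuc]] := unif_continuous_test_pairs cY.
have [M /(@countable_network_sub _ E) MP] := compact_countable_network cX.
have /choice[D DP] : forall n, exists D : set (set_type E),
    [/\ clopen D, f @^-1` (PQ n).1 `<=` D & D `&` f @^-1` (PQ n).2 = set0].
  move=> n; have [cP cQ PQ0] := PQP n.
  apply: (clopen_separation zE MP).
  - by apply: (preimage_closed _ cP) => x _; exact: cf.
  - by apply: (preimage_closed _ cQ) => x _; exact: cf.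
  - by rewrite -preimage_setI PQ0 preimage_set0.
exists (fun x => (fun n => `[< D n x >]) : cantor_space); split.
  by apply: continuous_to_cantor => n; case: (DP n).
move=> A gA; apply: PQuc => n; apply: filterS (gA n) => -[x y] /= gxy [Px Qy].
have [_ PD DQ] := DP n.
have Dx : D n (set_val x) by exact: PD.
have Dy : D n (set_val y) by apply/asboolP; rewrite -gxy; exact/asboolP.
have : (D n `&` f @^-1` (PQ n).2) (set_val y) by [].
by rewrite DQ.
Qed.

(** If uniform continuity of [g] on a set implies that of [f], and [phi] has an
    inverse each of whose coordinates is uniformly continuous on the image, then
    [phi \o g] is no better than [f]. *)
Lemma not_unif_continuous_comp (R : realType) (U : Type) (K : set U)
  (T Y : uniformType) (S : pseudoMetricType R) (f : T -> Y)
  (g : T -> cantor_space) (phi : cantor_space -> S) :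
  (forall A : set T,
      (forall n, \forall xy \near @entourage (set_type A),
         g (set_val xy.1) n = g (set_val xy.2) n) ->
      unif_continuous (sigL A f)) ->
  (forall n, exists2 e : R, 0 < e &
     forall b c, ball (phi b) e (phi c) -> b n = c n) ->
  not_unif_continuous_on_card K f ->
  not_unif_continuous_on_card K (phi \o g).
Proof.
move=> gf sep nf A AK ucA; apply: (nf A AK); apply: gf => n.
have [e e0 eb] := sep n.
have ball_gA : entourage [set xy : set_type A * set_type A |
    ball (phi (g (set_val xy.1))) e (phi (g (set_val xy.2)))].
  exact: ucA _ (entourage_ball S (PosNum e0)).
by apply: filterS ball_gA => -[x y] /= /eb.
Qed.

Theorem theorem3p1 (R : realType) (U : Type) (K : set U)
  (aleph1_le_K : ~ countable K)
  (K_le_continuum : K #<= [set: nat -> bool])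
  (X : metricType R) (X_compact : compact [set: X])
  (E : set X) (E_zero_dim : has_clopen_basis (set_type E))
  (hypY : exists (Y : metricType R) (f : set_type E -> Y),
    [/\ compact [set: Y], continuous f & not_unif_continuous_on_card K f]) :
  (exists f : set_type E -> set_type (cantor_ternary R),
    continuous f /\ not_unif_continuous_on_card K f) /\
  (forall Z : metricType R, compact [set: Z] -> ~ countable [set: Z] ->
    exists f : set_type E -> Z,
      continuous f /\ not_unif_continuous_on_card K f).
Proof.
have [Y [f [cY cf nf]]] := hypY.
have [g [cg gf]] := bitwise_test_function X_compact E_zero_dim cY cf.
split.
- pose phi b : set_type (cantor_ternary R) :=
    exist _ (ternary R b) (mem_set (@ternary_in_cantor R b)).
  exists (phi \o g); split.
    apply: continuous_comp_initial => x.
    apply: (@continuous_comp _ _ _ g (ternary R)); first exact: cg.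
    exact: ternary_continuous.
  apply: (not_unif_continuous_comp gf) nf => n.
  have [e e0 eb] := continuous_injection_separates_bits n (@Rhausdorff R)
    (@ternary_continuous R) (@ternary_inj R).
  (* The balls of the subtype are by definition traces of the balls of [R]. *)
  by exists e.
- move=> Z cZ uZ.
  have [phi cphi iphi] := cantor_embedding cZ (@metric_hausdorff R Z) uZ.
  exists (phi \o g); split.
    by move=> x; apply: continuous_comp; [exact: cg|exact: cphi].
  apply: (not_unif_continuous_comp gf) nf => n.
  exact: continuous_injection_separates_bits (@metric_hausdorff R Z) cphi iphi.
Qed.
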